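(* Let $\mathcal{A}$ be a regular category with enough (regular) projectives. A simplicial morphism $f\colon A\to B$ in $\mathcal{A}$ is a Kan fibration if and only if for every (regular) projective object $P$ of $\mathcal{A}$, the induced morphism of simplicial sets $$f\circ(\cdot)=\mathrm{Hom}(P,f)\colon \mathrm{Hom}(P,A)\to \mathrm{Hom}(P,B)$$ is a Kan fibration of simplicial sets.
   Context: A regular category is a finitely complete category with coequalizers of kernel pairs in which regular epimorphisms are pullback-stable. An object $P$ is (regular) projective if $\mathrm{Hom}(P,\cdot)$ sends regular epimorphisms to surjections; $\mathcal{A}$ has enough projectives if for every object $X$ there is a regular epimorphism $P\to X$ with $P$ projective. For a simplicial object $A$ (face operators $\partial_i\colon A_n\to A_{n-1}$, $i\in[n]=\{0,\dots,n\}$), $\mathrm{Hom}(P,A)$ is the simplicial set with $\mathrm{Hom}(P,A)_n=\mathrm{Hom}(P,A_n)$. Kan fibrations in a regular category: let $A$ be a simplicial object of $\mathcal{A}$. For $n\geq 1$ and $k\in[n]$, a family $x=(x_i\colon X\to A_{n-1})_{i\in[n],\,i\neq k}$ of morphisms with common domain $X$ is an $(n,k)$-horn of $A$ if $\partial_i\circ x_j=\partial_{j-1}\circ x_i$ for all $i<j$ with $i,j\neq k$. A map $f\colon A\to B$ of simplicial objects is a Kan fibration if, for every $n\ge 1$, $k\in[n]$, every $(n,k)$-horn $x=(x_i\colon X\to A_{n-1})$ of $A$ and every $b\colon X\to B_n$ with $\partial_i\circ b=f_{n-1}\circ x_i$ for all $i\neq k$, there are a regular epimorphism $p\colon Y\to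 X$ and a map $a\colon Y\to A_n$ such that $f_n\circ a=b\circ p$ and $\partial_i\circ a=x_i\circ p$ for all $i\neq k$. Kan fibrations of simplicial sets are the usual ones. *)

(* Defs.v *)
From mathcomp Require Import all_boot.
From Stdlib Require List.
From Stdlib Require Import FunctionalExtensionality.
Set Implicit Arguments.
Unset Strict Implicit.
Unset Printing Implicit Defensive.

Declare Scope cat_scope.
Delimit Scope cat_scope with cat.

(** * Categories, functors, natural transformations *)

Record category := Category {
  ob :> Type;
  hom : ob -> ob -> Type;
  idm : forall X, hom X X;
  cmp : forall X Y Z, hom Y Z -> hom X Y -> hom X Z;
  cmp1m : forall X Y (f : hom X Y), cmp (idm Y) f = f;
  cmpm1 : forall X Y (f : hom X Y), cmp f (idm X) = f;
  cmpA : forall X Y Z W (h : hom Z W) (g : hom Y Z) (f : hom X Y),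
    cmp h (cmp g f) = cmp (cmp h g) f }.

Arguments hom {c} X Y.
Arguments idm {c} X.
Arguments cmp {c X Y Z} g f.
Notation "g \oc f" := (cmp g f)
  (at level 40, left associativity) : cat_scope.
Local Open Scope cat_scope.

Record functor (C D : category) := Functor {
  fob :> C -> D;
  fmap : forall X Y : C, hom X Y -> hom (fob X) (fob Y);
  fmap1 : forall X, fmap (idm X) = idm (fob X);
  fmapM : forall X Y Z (g : hom Y Z) (f : hom X Y),
    fmap (g \oc f) = fmap g \oc fmap f }.

Arguments fmap {C D} _ {X Y} _.

Record nattrans (C D : category) (F G : functor C D) := NatTrans {
  ncomp :> forall X : C, hom (F X) (G X);
  natural : forall (X Y : C) (u : hom X Y),
    ncomp Y \oc fmap F u = fmap G u \oc ncomp X }.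

Definition opposite (C : category) : category :=
  @Category C (fun X Y => @hom C Y X) (@idm C) (fun X Y Z g f => cmp f g)
    (fun X Y f => cmpm1 f) (fun X Y f => cmp1m f)
    (fun X Y Z W h g f => esym (cmpA f g h)).

Definition functor_comp (C D E : category) (G : functor D E) (F : functor C D) :
  functor C E.
Proof.
refine (@Functor C E (fun X => G (F X)) (fun X Y u => fmap G (fmap F u)) _ _).
- by move=> X; rewrite !fmap1.
- by move=> X Y Z g f; rewrite !fmapM.
Defined.

Definition whisker (C D E : category) (H : functor D E) (F G : functor C D)
  (a : nattrans F G) : nattrans (functor_comp H F) (functor_comp H G).
Proof.
refine (@NatTrans C E (functor_comp H F) (functor_comp H G)
          (fun X => fmap H (a X)) _).
by move=> X Y u; rewrite /= -!fmapM natural.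
Defined.

(* The category of sets: types and functions. *)
Definition Sets : category :=
  @Category Type (fun S T => S -> T) (fun S x => x)
    (fun S T U g f x => g (f x))
    (fun _ _ _ => erefl) (fun _ _ _ => erefl) (fun _ _ _ _ _ _ _ => erefl).

Definition Hom_functor (C : category) (P : C) : functor C Sets.
Proof.
refine (@Functor C Sets (fun X => hom P X) (fun X Y u g => u \oc g) _ _).
- by move=> X; apply: functional_extensionality => g; apply: cmp1m.
- by move=> X Y Z v u; apply: functional_extensionality => g; apply: esym (cmpA _ _ _).
Defined.

(** * Limits and regular categories *)

Section Regular.
Variable C : category.

Definition is_cone (J : category) (D : functor J C) (X : C)
    (q : forall j, hom X (D j)) : Prop :=
  forall (i j : J) (u : hom i j), fmap D u \oc q i = q j.

Definition is_limit (J : category) (D : functor J C) (L : C)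
    (p : forall j, hom L (D j)) : Prop :=
  is_cone p /\
  forall (X : C) (q : forall j, hom X (D j)), is_cone q ->
    exists! h : hom X L, forall j, p j \oc h = q j.

Definition finite_category (J : category) : Prop :=
  (exists s : seq J, forall j, List.In j s) /\
  (forall i j : J, exists s : seq (hom i j), forall u, List.In u s).

Definition finitely_complete : Prop :=
  forall (J : category) (D : functor J C), finite_category J ->
    exists (L : C) (p : forall j, hom L (D j)), is_limit p.

Definition is_pullback (X Y Z W : C) (f : hom X Z) (g : hom Y Z)
    (p : hom W X) (q : hom W Y) : Prop :=
  f \oc p = g \oc q /\
  forall (T : C) (u : hom T X) (v : hom T Y), f \oc u = g \oc v ->
    exists! h : hom T W, p \oc h = u /\ q \oc h = v.

Definition is_kernel_pair (X Y R : C) (f : hom X Y) (r1 r2 : hom R X) : Prop :=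
  is_pullback f f r1 r2.

Definition is_coequalizer (X Y Q : C) (u v : hom X Y) (q : hom Y Q) : Prop :=
  q \oc u = q \oc v /\
  forall (T : C) (t : hom Y T), t \oc u = t \oc v ->
    exists! h : hom Q T, h \oc q = t.

Definition regular_epi (X Y : C) (p : hom X Y) : Prop :=
  exists (R : C) (u v : hom R X), is_coequalizer u v p.

Definition regular_category : Prop :=
  [/\ finitely_complete,
      (forall (X Y R : C) (f : hom X Y) (r1 r2 : hom R X),
         is_kernel_pair f r1 r2 ->
         exists (Q : C) (q : hom X Q), is_coequalizer r1 r2 q)
    & (forall (X Y Z W : C) (f : hom X Z) (g : hom Y Z)
          (p : hom W X) (q : hom W Y),
         is_pullback f g p q -> regular_epi g -> regular_epi p)].

Definition projective (P : C) : Prop :=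
  forall (X Y : C) (e : hom X Y), regular_epi e ->
    forall g : hom P Y, exists h : hom P X, e \oc h = g.

Definition enough_projectives : Prop :=
  forall X : C, exists (P : C) (p : hom P X), projective P /\ regular_epi p.

End Regular.

(** * Simplicial objects *)

(* The object n of the simplex category stands for [n] = {0, ..., n} = 'I_n.+1. *)
Definition monotone m n (f : {ffun 'I_m.+1 -> 'I_n.+1}) : bool :=
  [forall i : 'I_m.+1, forall j : 'I_m.+1, (i <= j) ==> (f i <= f j)].

Lemma monotoneP m n (f : {ffun 'I_m.+1 -> 'I_n.+1}) :
  reflect (forall i j : 'I_m.+1, i <= j -> f i <= f j) (monotone f).
Proof.
apply: (iffP forallP) => [H i j|H i]; first by apply/implyP; apply: (forallP (H i)).
by apply/forallP => j; apply/implyP; apply: H.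
Qed.

Definition simplex_map m n := {f : {ffun 'I_m.+1 -> 'I_n.+1} | monotone f}.

Definition simplex_mk m n (f : 'I_m.+1 -> 'I_n.+1)
    (H : forall i j : 'I_m.+1, i <= j -> f i <= f j) : simplex_map m n.
Proof.
by exists [ffun i => f i]; apply/monotoneP => i j ij; rewrite !ffunE; apply: H.
Defined.

Definition simplex_id n : simplex_map n n := simplex_mk (f := id) (fun _ _ ij => ij).

Definition simplex_comp m n p (g : simplex_map n p) (f : simplex_map m n) :
    simplex_map m p :=
  simplex_mk (f := fun i => val g (val f i))
    (fun i j ij => monotoneP _ (valP g) _ _ (monotoneP _ (valP f) _ _ ij)).

Definition Simplex : category.
Proof.
refine (@Category nat simplex_map simplex_id simplex_comp _ _ _).
- by move=> m n f; apply: val_inj; apply/ffunP => i; rewrite /= !ffunE.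
- by move=> m n f; apply: val_inj; apply/ffunP => i; rewrite /= !ffunE.
- by move=> m n p q h g f; apply: val_inj; apply/ffunP => i; rewrite /= !ffunE.
Defined.

Lemma lift_mono n (k : 'I_n.+2) (i j : 'I_n.+1) : i <= j -> lift k i <= lift k j.
Proof. by move=> ij; rewrite leq_bump2. Qed.

(* The monotone injection [n] -> [n+1] that misses the value i. *)
Definition coface n (i : 'I_n.+2) : simplex_map n n.+1 :=
  simplex_mk (@lift_mono n i).

Definition simplicial_object (C : category) := functor (opposite Simplex) C.
Definition simplicial_map (C : category) (A B : simplicial_object C) := nattrans A B.
Definition simplicial_set := simplicial_object Sets.

Definition face (C : category) (A : simplicial_object C) n (i : 'I_n.+2) :
  hom (A n.+1) (A n) := fmap A (coface i : @hom (opposite Simplex) n.+1 n).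

Definition Hom_sset (C : category) (P : C) (A : simplicial_object C) :
  simplicial_set := functor_comp (Hom_functor P) A.

Definition Hom_smap (C : category) (P : C) (A B : simplicial_object C)
    (f : simplicial_map A B) : simplicial_map (Hom_sset P A) (Hom_sset P B) :=
  whisker (Hom_functor P) f.

(** * Horns and Kan fibrations *)

(* Below, the index n stands for n+1 in "(n,k)-horn, n >= 1". For (1,k)-horns
   there are no i < j both distinct from k, hence no condition; otherwise, as
   i < j, both i and j-1 lie in 'I_m.+2 and inord does not truncate them. *)
Definition is_horn (C : category) (A : simplicial_object C) (X : C) (n : nat) :
    forall k : 'I_n.+2, (forall i : 'I_n.+2, i != k -> hom X (A n)) -> Prop :=
  match n with
  | 0 => fun _ _ => True
  | m.+1 => fun k x =>
      forall (i j : 'I_m.+3) (ik : i != k) (jk : j != k), i < j ->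
        face A (inord i) \oc x j jk = face A (inord j.-1) \oc x i ik
  end.

Definition kan_fibration (C : category) (A B : simplicial_object C)
    (f : simplicial_map A B) : Prop :=
  forall (n : nat) (k : 'I_n.+2) (X : C)
         (x : forall i : 'I_n.+2, i != k -> hom X (A n)) (b : hom X (B n.+1)),
    is_horn x ->
    (forall (i : 'I_n.+2) (ik : i != k), face B i \oc b = f n \oc x i ik) ->
    exists (Y : C) (p : hom Y X) (a : hom Y (A n.+1)),
      [/\ regular_epi p,
          f n.+1 \oc a = b \oc p
        & forall (i : 'I_n.+2) (ik : i != k), face A i \oc a = x i ik \oc p].

Definition is_horn_sset (K : simplicial_set) (n : nat) :
    forall k : 'I_n.+2, (forall i : 'I_n.+2, i != k -> K n) -> Prop :=
  match n with
  | 0 => fun _ _ => True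
  | m.+1 => fun k x =>
      forall (i j : 'I_m.+3) (ik : i != k) (jk : j != k), i < j ->
        face K (inord i) (x j jk) = face K (inord j.-1) (x i ik)
  end.

Definition kan_fibration_sset (K L : simplicial_set) (f : simplicial_map K L) :
    Prop :=
  forall (n : nat) (k : 'I_n.+2)
         (x : forall i : 'I_n.+2, i != k -> K n) (y : L n.+1),
    is_horn_sset x ->
    (forall (i : 'I_n.+2) (ik : i != k), face L i y = f n (x i ik)) ->
    exists z : K n.+1,
      f n.+1 z = y /\ forall (i : 'I_n.+2) (ik : i != k), face K i z = x i ik.

(* Main.v *)
Require Import Defs.
From mathcomp Require Import all_boot.

(** A horn of the simplicial set Hom(P, A) is the same thing as a horn of A with
    domain P, so a Kan fibration of the sets Hom(P, -) is a lifting property of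
    f at the object P that holds without passing to a cover.  When P is
    projective, every regular epimorphism onto P splits, and a lift over a cover
    can be pulled back along a section to a lift over P itself.  Conversely, any
    domain X is covered by a projective P; after restriction along this cover a
    horn has a lift over P, which is a lift of the original horn in the sense of
    regular categories.  ([horn_Hom_sset], [projective_section] and
    [horn_precomp] are the three ingredients.) *)

Local Open Scope cat_scope.

(** Faces of Hom(P, A) act by composition, so both conditions unfold to the
    same equations; only the case split on the dimension hides this. *)
Lemma horn_Hom_sset (C : category) (A : simplicial_object C) (P : C) (n : nat)
    (k : 'I_n.+2) (x : forall i : 'I_n.+2, i != k -> hom P (A n)) :
  @is_horn_sset (Hom_sset P A) n k x <-> @is_horn C A P n k x.
Proof. by case: n k x. Qed.

Lemma horn_precomp (C : category) (A : simplicial_object C) (X Y : C)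
    (p : hom Y X) (n : nat) (k : 'I_n.+2)
    (x : forall i : 'I_n.+2, i != k -> hom X (A n)) :
  @is_horn C A X n k x -> @is_horn C A Y n k (fun i ik => x i ik \oc p).
Proof.
by case: n k x => [//|n] k x xhorn i j ik jk ij; rewrite !cmpA (xhorn i j ik jk ij).
Qed.

Lemma projective_section (C : category) (P Y : C) (p : hom Y P) :
  projective P -> regular_epi p -> exists s : hom P Y, p \oc s = idm P.
Proof. by move=> projP /projP; apply. Qed.

Theorem proposition1p1 (C : category) (hreg : regular_category C)
    (hproj : enough_projectives C) (A B : simplicial_object C)
    (f : simplicial_map A B) :
  kan_fibration f <->
  forall P : C, projective P -> kan_fibration_sset (Hom_smap P f).
Proof.
split=> [fibf P projP n k x b /horn_Hom_sset xhorn bx | fibf n k X x b xhorn bx].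
  have [Y [p [a [pepi fa ax]]]] := fibf n k P x b xhorn bx.
  have [s ps] := projective_section _ _ _ _ projP pepi.
  exists (a \oc s); split=> [|i ik].
    by change (f n.+1 \oc (a \oc s) = b); rewrite cmpA fa -cmpA ps cmpm1.
  by change (face A i \oc (a \oc s) = x i ik); rewrite cmpA ax -cmpA ps cmpm1.
have [P [p [projP pepi]]] := hproj X.
have [||a [fa ax]] := fibf P projP n k (fun i ik => x i ik \oc p) (b \oc p).
- exact/horn_Hom_sset/horn_precomp.
- move=> i ik; change (face B i \oc (b \oc p) = f n \oc (x i ik \oc p)).
  by rewrite !cmpA bx.
by exists P, p, a; split.
Qed.
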